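(* Let $a$ be an even integer and $b$ an odd integer with $a > b \geq 1$. Then the equation $3^{a}+3^{b}+2=n^5$ has no solution in positive integers $n$; that is, there is no triple $(a,b,n)$ of positive integers with $a$ even, $b$ odd, $a>b\geq 1$, and $3^{a}+3^{b}+2=n^5$.
   Context: ''Insoluble'' means there are no solutions in positive integers. All variables $a,b,n$ are positive integers. *)

(* Defs.v *)
From mathcomp Require Import all_boot.

(* Main.v *)
Require Import Defs.
From mathcomp Require Import all_boot.

(** The obstruction is 2-adic. Modulo 4 we have 3 = -1, so [3 ^ m] depends only
    on the parity of [m] ([expn3_mod4]), and for [a] even and [b] odd the left
    side is congruent to 1 + 3 + 2, that is, to 2. But 2 is not a fifth power
    modulo 4 ([expn5_mod4_neq2]): an even fifth power is divisible by 32. *)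

Lemma expn3_mod4 m : 3 ^ m %% 4 = if odd m then 3 else 1.
Proof. by elim: m => [|m IHm] //=; rewrite expnS -modnMmr IHm; case: (odd m). Qed.

Lemma expn5_mod4_neq2 n : n ^ 5 %% 4 != 2.
Proof.
rewrite -modnXm.
by case: (n %% 4) (ltn_pmod n (isT : 0 < 4)) => [|[|[|[|r]]]].
Qed.

Theorem lemma2 (a b : nat) (ha : ~~ odd a) (hb : odd b) (hab : 1 <= b < a) :
  ~ exists n : nat, 0 < n /\ 3 ^ a + 3 ^ b + 2 = n ^ 5.
Proof.
case=> n [_ eq_n5]; move: (expn5_mod4_neq2 n).
rewrite -eq_n5 -modnDml -(modnDm (3 ^ a)).
by rewrite !expn3_mod4 (negbTE ha) hb.
Qed.
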